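(* Suppose that $\mu$ is a Borel probability measure on $\mathbb R$, $\nu$ is an increasing (resp. decreasing) location-scale transform of $\mu$, and $h:[0,\infty)^2\to\mathbb R$ is a submodular function. Then the comonotone coupling $\pi_{\rm com}$ (resp. the antimonotone coupling $\pi_{\rm ant}$) is a minimizer of the QOT problem with the cost function $c$ given by $$c(x,y,x',y')=h(|x-x'|,|y-y'|).$$ Moreover, such a minimizer is unique if it yields a finite transport cost, $h$ is strictly submodular, and $\mu$ is asymmetric. In the same setting except that $\mu$ is symmetric, the comonotone and antimonotone couplings are the only minimizers.
   Context: $\Pi(\mu,\nu)$ is the set of all probability measures on $\mathbb R^2$ with marginals $\mu,\nu$. The quadratic-form optimal transport (QOT) problem with cost function $c:\mathbb R^4\to\mathbb R$ is to minimize the transport cost $\iint c(x,y,x',y')\,\mathrm d\pi(x,y)\,\mathrm d\pi(x',y')$ over all $\pi\in\Pi(\mu,\nu)$ for which this integral is well-defined (possibly infinite); cost functions are tacitly assumed to be suitably measurable. $\nu$ is an increasing (resp. decreasing) location-scale transform of $\mu$ if $\nu=\mu\circ\ell^{-1}$ with $\ell(x)=ax+b$ for some $a>0$ (resp. $a<0$) and $b\in\mathbb R$. $h$ is submodular if $h(u,v)+h(u',v')\le h(u,v')+h(u',v)$ for all $u<u'$, $v<v'$, and strictly submodular if the inequality is always strict. $\mu$ is symmetric if there exists $m\in\mathbb R$ with $\mu(A)=\mu(m-A)$ for all Borel sets $A\subseteq\mathbb R$; otherwise $\mu$ is asymmetric. $Q_\mu(t)=\inf\{x\in\mathbb R:\mu((-\infty,x])\ge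 t\}$ is the left quantile function. With $U$ uniform on $[0,1]$, $\pi_{\rm com}\in\Pi(\mu,\nu)$ is the law of $(Q_\mu(U),Q_\nu(U))$ and $\pi_{\rm ant}\in\Pi(\mu,\nu)$ is the law of $(Q_\mu(U),Q_\nu(1-U))$.
   Formalization: The claim that the comonotone (resp. antimonotone) coupling is a minimizer is made only when its own transport-cost integral is well-defined; otherwise it is not an admissible competitor and cannot be a minimizer. *)

(* Defs.v *)
From HB Require Import structures.
From mathcomp Require Import all_boot all_order all_algebra.
From mathcomp Require Import all_classical all_reals all_analysis.
From mathcomp Require Import measurable_realfun.

Set Implicit Arguments.
Unset Strict Implicit.
Unset Printing Implicit Defensive.

Import Order.TTheory GRing.Theory Num.Theory.
Import numFieldNormedType.Exports.

Local Open Scope classical_set_scope.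
Local Open Scope ring_scope.

Section qot.
Context {R : realType}.
Local Notation T := (measurableTypeR R).
Implicit Types (mu nu : probability T R) (pi rho : probability (T * T)%type R).
Implicit Types (c : R -> R -> R -> R -> R) (h : R -> R -> R).

(* Measures are compared on measurable sets only: the values of a mathcomp
   measure outside the sigma-algebra are unconstrained. *)
Definition same_measure d (X : measurableType d) (P Q : probability X R) :=
  forall A, measurable A -> P A = Q A.

Definition coupling mu nu pi :=
  (forall A : set T, measurable A -> pi (A `*` setT) = mu A) /\
  (forall B : set T, measurable B -> pi (setT `*` B) = nu B).

Definition cost4 c (z : (T * T) * (T * T)) : \bar R :=
  (c z.1.1 z.1.2 z.2.1 z.2.2)%:E.

Definition measurable_cost c :=
  measurable_fun setT (fun z : (T * T) * (T * T) => c z.1.1 z.1.2 z.2.1 z.2.2 : T).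

Definition qot_cost c pi : \bar R := (\int[pi \x pi]_z cost4 c z)%E.

(* The library integral is the difference of the integrals of the positive and
   negative parts and is total (+oo - +oo = -oo), so the existence of the
   integral in [-oo, +oo] is a separate condition. *)
Definition qot_well_defined c pi :=
  ((\int[pi \x pi]_z (cost4 c)^\+ z < +oo) \/
   (\int[pi \x pi]_z (cost4 c)^\- z < +oo))%E.

Definition qot_finite c pi :=
  qot_well_defined c pi /\ qot_cost c pi \is a fin_num.

Definition qot_admissible c mu nu pi :=
  coupling mu nu pi /\ qot_well_defined c pi.

Definition qot_minimizer c mu nu pi :=
  qot_admissible c mu nu pi /\
  forall rho, qot_admissible c mu nu rho -> (qot_cost c pi <= qot_cost c rho)%E.

(* [h] stands for a function on [0, +oo[ ^ 2; its values elsewhere are junk. *)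
Definition submodular h := forall u u' v v' : R,
  0 <= u -> 0 <= v -> u < u' -> v < v' -> h u v + h u' v' <= h u v' + h u' v.

Definition strictly_submodular h := forall u u' v v' : R,
  0 <= u -> 0 <= v -> u < u' -> v < v' -> h u v + h u' v' < h u v' + h u' v.

Definition abs_diff_cost h (x y x' y' : R) : R := h `|x - x'| `|y - y'|.

Definition increasing_location_scale mu nu := exists a b : R, 0 < a /\
  forall A : set T, measurable A ->
    nu A = pushforward mu ((fun x => a * x + b) : T -> T) A.

Definition decreasing_location_scale mu nu := exists a b : R, a < 0 /\
  forall A : set T, measurable A ->
    nu A = pushforward mu ((fun x => a * x + b) : T -> T) A.

Definition symmetric_measure mu := exists m : R,
  forall A : set T, measurable A -> mu A = mu [set m - x | x in A].

(* For t <= 0, t > 1, and possibly t = 1, the infimum is not a real number and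
   [inf] returns 0; only 0 < t < 1 matters under the uniform law. *)
Definition quantile mu (t : R) : R := inf [set x : R | (t%:E <= mu `]-oo, x]%classic)%E].

End qot.

Section quantile_measurability.
Context {R : realType}.
Local Notation T := (measurableTypeR R).
Implicit Types mu nu : probability T R.

Let idT : T -> R := idfun.
#[local] HB.instance Definition _ :=
  @isMeasurableFun.Build _ _ _ _ idT (@measurable_id _ _ setT).

Let cdfE mu x : cdf (idT : {RV mu >-> R}) x = mu `]-oo, x]%classic.
Proof. by []. Qed.

Lemma quantile_set_nonempty mu (t : R) : t < 1 ->
  [set x : R | (t%:E <= mu `]-oo, x]%classic)%E] !=set0.
Proof.
move=> t1; have /= := cvg_cdfy1 (idT : {RV mu >-> R}).
move=> /(_ [set y : \bar R | t%:E < y]%E) [].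
  by apply: open_nbhs_nbhs; split; [exact: open_ereal_gt_ereal|rewrite /= lte_fin].
move=> M [_ /(_ (M + 1))]; rewrite ltrDl ltr01 => /(_ isT)/= tM.
by exists (M + 1); exact: ltW.
Qed.

Lemma quantile_set_lbound mu (t : R) : 0 < t ->
  has_lbound [set x : R | (t%:E <= mu `]-oo, x]%classic)%E].
Proof.
move=> t0; have /= := cvg_cdfNy0 (idT : {RV mu >-> R}).
move=> /(_ [set y : \bar R | y < t%:E]%E) [].
  by apply: open_nbhs_nbhs; split; [exact: open_ereal_lt_ereal|rewrite /= lte_fin].
move=> M [_ HM]; exists M => x /= tx; rewrite leNgt; apply/negP => /HM/=.
by rewrite cdfE ltNge tx.
Qed.

Lemma le_quantile mu (s t : R) : 0 < s -> s <= t -> t < 1 ->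
  quantile mu s <= quantile mu t.
Proof.
move=> s0 st t1; apply: lb_le_inf; first exact: quantile_set_nonempty.
move=> x /= tx; apply: ge_inf; first exact: quantile_set_lbound.
by rewrite /= (le_trans _ tx)// lee_fin.
Qed.

Lemma quantile_le0 mu (t : R) : t <= 0 -> quantile mu t = 0.
Proof.
move=> t0; rewrite /quantile inf_out// => -[_ [M /(_ (M - 1))]] /=.
have /[swap]/[apply] : (t%:E <= mu `]-oo, (M - 1)%R]%classic)%E.
  by rewrite (le_trans _ (measure_ge0 _ _))// lee_fin.
by rewrite leNgt ltrBlDr ltrDl ltr01.
Qed.

Lemma quantile_gt1 mu (t : R) : 1 < t -> quantile mu t = 0.
Proof.
move=> t1; rewrite /quantile inf_out// => -[[x /= tx] _].
have mux : (mu `]-oo, x]%classic <= 1)%E by exact: probability_le1.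
by move: (le_trans tx mux); rewrite lee_fin leNgt t1.
Qed.

Lemma measurable_quantile mu : measurable_fun [set: T] (quantile mu : T -> T).
Proof.
have -> : [set: T] =
    `]-oo, 0%R] `|` (`]0%R, 1%R[ `|` ([set 1] `|` `]1%R, +oo[)).
  apply/seteqP; split => // x _ /=; rewrite !in_itv/= andbT.
  have [?|x0] := leP x 0; first by left.
  by right; have [x1|x1|->] := ltgtP x 1; [left|right; right|right; left].
have mI : measurable (`]0%R, 1%R[ : set T) by exact: measurable_itv.
apply/measurable_funU => //.
  by do !apply: measurableU => //; exact: measurable_set1.
split.
  apply: (@eq_measurable_fun _ _ T T _ (cst (0 : R))) => // x.
  by rewrite inE/= in_itv/= => x0; rewrite quantile_le0.
apply/measurable_funU => //; first exact: measurableU.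
split.
  apply: (measurability (@RGenCInfty.G R)) => [|/= _ [_] [r] -> <-].
    exact: RGenCInfty.measurableE.
  apply: is_interval_measurable => s t/=.
  rewrite !in_itv/= !andbT => -[/andP[s0 s1] fs] [/andP[t0 t1] ft] u.
  move=> /andP[su ut]; rewrite !in_itv/= ?andbT.
  rewrite (lt_le_trans s0 su) (le_lt_trans ut t1); split => //.
  by rewrite (le_trans fs)// le_quantile// (le_lt_trans ut).
apply/measurable_funU => //; split.
  exact: measurable_fun_set1.
apply: (@eq_measurable_fun _ _ T T _ (cst (0 : R))) => // x.
by rewrite inE/= in_itv/= andbT => x1; rewrite quantile_gt1.
Qed.

End quantile_measurability.

Section monotone_couplings.
Context {R : realType}.
Local Notation T := (measurableTypeR R).
Implicit Types mu nu : probability T R.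

Definition com_map mu nu (u : T) : T * T := (quantile mu u, quantile nu u).

Definition ant_map mu nu (u : T) : T * T := (quantile mu u, quantile nu (1 - u)).

Lemma measurable_com_map mu nu : measurable_fun setT (com_map mu nu).
Proof. by apply: measurable_fun_pair; exact: measurable_quantile. Qed.

Lemma measurable_ant_map mu nu : measurable_fun setT (ant_map mu nu).
Proof.
apply: measurable_fun_pair; first exact: measurable_quantile.
apply: (measurableT_comp (measurable_quantile nu)) => /=.
exact: measurable_funB.
Qed.

HB.instance Definition _ mu nu :=
  isMeasurableFun.Build _ _ _ _ (com_map mu nu) (measurable_com_map mu nu).
HB.instance Definition _ mu nu :=
  isMeasurableFun.Build _ _ _ _ (ant_map mu nu) (measurable_ant_map mu nu).

Definition pi_com mu nu : probability (T * T)%type R :=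
  distribution (uniform_prob (@ltr01 R)) (com_map mu nu).

Definition pi_ant mu nu : probability (T * T)%type R :=
  distribution (uniform_prob (@ltr01 R)) (ant_map mu nu).

End monotone_couplings.

(* Main.v *)
Require Import Defs.
From HB Require Import structures.
From mathcomp Require Import all_boot all_order all_algebra.
From mathcomp Require Import all_classical all_reals all_analysis.
From mathcomp Require Import measurable_realfun lra.

(** Let [nu] be the law of [a X + b] with [X] of law [mu] and [a != 0], and let
[(X, Y)], [(X', Y')] be independent with law [pi], a coupling of [mu] and [nu].
Put [Z := (Y - b) / a], so that [Z] has law [mu] as well.  The two distances
[U := |X - X'|] and [V := |Z - Z'|] then have the same law, whatever [pi] is,
and the cost of [pi] is the expectation of [H (U, V)] where
[H (u, v) := h (u, |a| v)] is again submodular.  So the quadratic problem is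
bounded below by a linear transport problem between two equal laws, solved by
the diagonal coupling [U = V]; and [U = V] is realized by [Z = X], that is, by
the law of [(X, a X + b)].  This law is the comonotone coupling if [a > 0] and
the antimonotone one if [a < 0] ([pi_com_affine], [pi_ant_affine]).

No integrability is assumed of [H], so that the linear problem is solved with
a dual potential: there is a measurable [g] with
[H (u, u) + g v - g u <= H (u, v)], strictly if [H] is strictly submodular and
[u != v] ([diag_potential_le], [diag_potential_lt]).  It is built from sums
along increasing chains, because [H] need not be continuous.  As [g U] and
[g V] have the same law, the positive and negative parts of [g V - g U] have
the same integral even when [g U] is not integrable
([integral_max0B_same_law]); hence [H (U, U)] and [H (U, V)] can be compared
([integral_le_exact_transport]), and equality of finite costs forces [U = V]
almost surely ([exact_transport_ae_eq]).

If [|X - X'| = |Z - Z'|] almost surely, then almost surely [Z - X] is constant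
or [Z + X] is constant ([isometric_ae]).  In the first case the constant is
zero, since [X] and [Z] have the same law.  In the second one [mu] is
symmetric, about half the constant [m], and [pi] is the law of
[(X, a (m - X) + b)].  The slope of this affine map is [- a], so that [pi] is
the monotone coupling of the opposite direction, and its cost is the same
because only [|a|] enters [H]. *)

Set Implicit Arguments.
Unset Strict Implicit.
Unset Printing Implicit Defensive.

Import Order.TTheory GRing.Theory Num.Theory.
Import numFieldNormedType.Exports.

Local Open Scope classical_set_scope.
Local Open Scope ring_scope.

(** * Dual potential of a submodular function on the diagonal *)

Section diagonal_potential.
Context {R : realType}.
Implicit Types (h : R -> R -> R) (u v w s : R).

(** If [h] is submodular then, up to terms that depend on a single variable, [- h]
is a nonnegative function, nondecreasing in each variable; this is its
increment from [(u, u)] to [(u, v)]. *)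
Definition diag_excess h u v : R := h 0 v - h 0 u - (h u v - h u u).

(** Sums of increments along a chain from [0] to the point given first.  The
potential of a general cyclically monotone set takes all chains; increasing
ones suffice on the diagonal and make the supremum monotone. *)
Inductive chain_sum h : R -> R -> Prop :=
| chain_sum0 : chain_sum h 0 0
| chain_sumS u s v : chain_sum h u s -> u <= v ->
    chain_sum h v (s + diag_excess h u v).

Definition sup_chain h v : R := sup [set s | chain_sum h v s].

Lemma submodular_le h u u' v v' : submodular h ->
  0 <= u -> 0 <= v -> u <= u' -> v <= v' -> h u v + h u' v' <= h u v' + h u' v.
Proof.
move=> hs u0 v0; rewrite le_eqVlt => /predU1P[<-|uu'] => [_|].
  by rewrite addrC.
by rewrite le_eqVlt => /predU1P[<- //|vv']; exact: hs.
Qed.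

Lemma diag_excess_ge0 h u v : submodular h -> 0 <= u -> u <= v ->
  0 <= diag_excess h u v.
Proof.
move=> hs u0 uv; have := submodular_le hs (lexx 0) u0 u0 uv.
by rewrite /diag_excess; lra.
Qed.

(** Going from [v] to [u] through a point [w] above both does not increase the
excess: in terms of [h] this is the submodular inequality for [v <= w] and
[u <= w]. *)
Lemma diag_excess_cycle h u v w : submodular h -> 0 <= u -> 0 <= v ->
  u <= w -> v <= w ->
  diag_excess h v w - diag_excess h v u + diag_excess h w u <= 0.
Proof.
move=> hs u0 v0 uw vw; have := submodular_le hs v0 u0 vw uw.
by rewrite /diag_excess; lra.
Qed.

Lemma chain_sum_ge0 h v s : chain_sum h v s -> 0 <= v.
Proof. by elim => // u {}s {}v _ u0 uv; exact: le_trans uv. Qed.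

Lemma chain_sum_ubound h v s : submodular h -> chain_sum h v s ->
  s <= - diag_excess h v 0.
Proof.
move=> hs; elim => [|u {}s {}v Cus IH uv]; first by rewrite /diag_excess; lra.
have u0 := chain_sum_ge0 Cus.
have := diag_excess_cycle hs (lexx 0) u0 (le_trans u0 uv) uv.
by move: IH; lra.
Qed.

Lemma le_sup_chain h v s : submodular h -> chain_sum h v s ->
  s <= sup_chain h v.
Proof.
move=> hs Cvs; apply: ub_le_sup => //.
by exists (- diag_excess h v 0) => t /= /chain_sum_ubound; exact.
Qed.

Lemma chain_sum_nonempty h v : 0 <= v -> [set s | chain_sum h v s] !=set0.
Proof.
by move=> v0; exists (0 + diag_excess h 0 v); apply: chain_sumS v0; left.
Qed.

(** If [u <= v], append [v] to a chain that ends at [u].  If [v < u], continue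
that chain by a step back to [v] and remove its points above [v], the last one
first: by [diag_excess_cycle] this does not decrease the sum, and what is left
is an increasing chain that ends at [v]. *)
Lemma diag_excess_le_sup_chain h u v : submodular h -> 0 <= u -> 0 <= v ->
  diag_excess h u v <= sup_chain h v - sup_chain h u.
Proof.
move=> hs u0 v0; rewrite lerBrDl addrC -lerBrDl.
apply: ge_sup; first exact: chain_sum_nonempty.
move=> s /= Cus; elim: Cus v0 => {u u0 s}[|u s w Cus IH uw] v0.
  have : chain_sum h v (0 + diag_excess h 0 v).
    by apply: chain_sumS v0; left.
  by move=> /(le_sup_chain hs); lra.
have u0 := chain_sum_ge0 Cus.
have [wv|vw] := leP w v.
  have := le_sup_chain hs (chain_sumS (chain_sumS Cus uw) wv); lra.
have := diag_excess_cycle hs v0 u0 (ltW vw) uw.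
have [vu|uv] := leP v u; first by have := IH v0; lra.
by have := le_sup_chain hs (chain_sumS Cus (ltW uv)); lra.
Qed.

(** The measurability of the potential rests on this.  On negative arguments
[sup_chain h] is the supremum of the empty set, that is [0]. *)
Lemma sup_chain_nondecreasing h : submodular h ->
  {homo sup_chain h : u v / u <= v}.
Proof.
move=> hs u v uv; have [u0|u0] := leP 0 u.
  rewrite -subr_ge0; apply: le_trans (diag_excess_le_sup_chain hs u0 _).
    exact: diag_excess_ge0.
  exact: le_trans uv.
have -> : sup_chain h u = 0.
  rewrite /sup_chain sup_out// => -[[s /chain_sum_ge0]].
  by rewrite leNgt u0.
have [v0|v0] := leP 0 v.
  have : chain_sum h v (0 + diag_excess h 0 v) by apply: chain_sumS v0; left.
  move=> /(le_sup_chain hs); apply: le_trans.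
  by rewrite add0r diag_excess_ge0.
rewrite /sup_chain sup_out// => -[[s /chain_sum_ge0]].
by rewrite leNgt v0.
Qed.

Definition diag_potential h v : R := h 0 v - sup_chain h v.

Lemma diag_potential_le h u v : submodular h -> 0 <= u -> 0 <= v ->
  h u u + (diag_potential h v - diag_potential h u) <= h u v.
Proof.
move=> hs u0 v0; have := diag_excess_le_sup_chain hs u0 v0.
by rewrite /diag_excess /diag_potential; lra.
Qed.

Lemma strictly_submodularW h : strictly_submodular h -> submodular h.
Proof. by move=> hs u u' v v' *; apply/ltW/hs. Qed.

(** The weak inequality for the pairs [(u, m)] and [(m, v)], with [m] the
midpoint, is strictly better than the one for [(u, v)], by strict
submodularity. *)
Lemma diag_potential_lt h u v : strictly_submodular h ->
  0 <= u -> 0 <= v -> u != v ->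
  h u u + (diag_potential h v - diag_potential h u) < h u v.
Proof.
move=> hs u0 v0 uv; have hw := strictly_submodularW hs.
have m0 : 0 <= (u + v) / 2 by lra.
have := diag_potential_le hw u0 m0; have := diag_potential_le hw m0 v0.
suff : h u ((u + v) / 2) + h ((u + v) / 2) v <
       h u v + h ((u + v) / 2) ((u + v) / 2) by lra.
have [{}uv|vu|uvE] := ltgtP u v; last by rewrite uvE eqxx in uv.
  have um : u < (u + v) / 2 by lra.
  have mv : (u + v) / 2 < v by lra.
  by have := hs _ _ _ _ u0 m0 um mv; lra.
have vm : v < (u + v) / 2 by lra.
have mu : (u + v) / 2 < u by lra.
by have := hs _ _ _ _ m0 v0 mu vm; lra.
Qed.

End diagonal_potential.

(** * Differences of two random variables with the same law *)

Section same_law.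
Context d (Om : measurableType d) {R : realType} (P : probability Om R).
Implicit Types (f g : Om -> R).
Local Notation T := (measurableTypeR R).

Definition same_law (A B : Om -> R) :=
  forall S : set T, measurable S -> P (A @^-1` S) = P (B @^-1` S).

Lemma ge0_integral_same_law (A B : Om -> T) (f : T -> \bar R) :
  measurable_fun setT A -> measurable_fun setT B -> same_law A B ->
  measurable_fun setT f -> (forall x, 0 <= f x)%E ->
  (\int[P]_w f (A w) = \int[P]_w f (B w))%E.
Proof.
move=> mA mB AB mf f0.
have pushE (C : Om -> T) : measurable_fun setT C ->
    (\int[P]_w f (C w) = \int[pushforward P C]_x f x)%E.
  by move=> mC; rewrite ge0_integral_pushforward// preimage_setT.
rewrite (pushE _ mA) (pushE _ mB).
by apply: eq_measure_integral => S mS _; exact: AB.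
Qed.

Definition clamp (n : nat) (x : R) : R :=
  Num.max (- n%:R) (Num.min x n%:R).

Lemma clamp_ge (n : nat) x : 0 <= clamp n x + n%:R.
Proof. by rewrite -lerBlDr sub0r le_max lexx. Qed.

Lemma clamp_le (n : nat) x : clamp n x + n%:R <= n%:R + n%:R.
Proof.
rewrite lerD2r ge_max ge_min lexx orbT andbT.
by rewrite -subr_ge0 opprK addr_ge0.
Qed.

Lemma clamp_id (n : nat) x : `|x| <= n%:R -> clamp n x = x.
Proof.
rewrite ler_norml => /andP[nx xn].
by rewrite /clamp min_l// max_r.
Qed.

Lemma clamp_clamp (m n : nat) x : (m <= n)%N -> clamp m (clamp n x) = clamp m x.
Proof.
rewrite -(ler_nat R) => mn; have m0 : 0 <= m%:R :> R by [].
rewrite /clamp; case: (lerP x n%:R) => xn.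
  by case: (lerP (- n%:R) x) => // nx; rewrite !min_l ?max_l; lra.
rewrite (max_r (x := - n%:R)); last lra.
by rewrite !min_r//; lra.
Qed.

Lemma clamp_contraction (n : nat) x y :
  Num.max (clamp n y - clamp n x) 0 <= Num.max (y - x) 0.
Proof.
have n0 : 0 <= n%:R :> R by [].
rewrite ge_max !le_max lexx orbT andbT /clamp.
case: (lerP x n%:R) => xn; case: (lerP y n%:R) => yn;
  do 2 ?[case: (lerP (- n%:R)) => ?];
  by have [yx|xy] := leP y x; apply/orP; [right|left]; lra.
Qed.

Lemma clamp_diff_homo (m n : nat) x y : (m <= n)%N ->
  Num.max (clamp m y - clamp m x) 0 <= Num.max (clamp n y - clamp n x) 0.
Proof.
by move=> mn; rewrite -(clamp_clamp x mn) -(clamp_clamp y mn) clamp_contraction.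
Qed.

Lemma measurable_clamp n : measurable_fun setT (clamp n : T -> T).
Proof.
by apply: measurable_maxr => //; apply: measurable_minr.
Qed.

(** If [A] and [B] were integrable this would say that [B - A] has integral zero.
For [A] and [B] truncated at level [n] it does.  Truncation is a monotone
contraction, so the positive parts of the truncated differences increase to
that of [B - A], and monotone convergence concludes. *)
Lemma integral_max0B_same_law (A B : Om -> T) :
  measurable_fun setT A -> measurable_fun setT B -> same_law A B ->
  (\int[P]_w (Num.max (B w - A w) 0)%:E =
   \int[P]_w (Num.max (A w - B w) 0)%:E)%E.
Proof.
move=> mA mB AB.
pose D (C1 C2 : Om -> R) n w : \bar R :=
  (Num.max (clamp n (C2 w) - clamp n (C1 w)) 0)%:E.
have mcl n (C : Om -> T) : measurable_fun setT C ->
    measurable_fun setT (clamp n \o C : Om -> T).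
  by move=> mC; apply: measurableT_comp => //; exact: measurable_clamp.
have mclE n (C : Om -> T) : measurable_fun setT C ->
    measurable_fun setT (fun w => (clamp n (C w) + n%:R)%:E).
  by move=> mC; apply/measurable_EFinP/measurable_funD => //; exact: mcl.
have mD (C1 C2 : Om -> T) n : measurable_fun setT C1 -> measurable_fun setT C2 ->
    measurable_fun setT (D C1 C2 n).
  move=> m1 m2; apply/measurable_EFinP.
  by apply: measurable_maxr => //; apply: measurable_funB; exact: mcl.
have D0 C1 C2 n w : (0 <= D C1 C2 n w)%E by rewrite lee_fin le_max lexx orbT.
(* Both sides of max (b - a) 0 + a = max (a - b) 0 + b, shifted by n to be
   nonnegative, are integrated; the integrals of a and b then cancel. *)
have intE n : (\int[P]_w D A B n w = \int[P]_w D B A n w)%E.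
  have : (\int[P]_w D A B n w + \int[P]_w (clamp n (A w) + n%:R)%:E =
          \int[P]_w D B A n w + \int[P]_w (clamp n (B w) + n%:R)%:E)%E.
    have c0 (C : Om -> R) w : setT w -> (0 <= (clamp n (C w) + n%:R)%:E)%E.
      by move=> _; rewrite lee_fin clamp_ge.
    rewrite -!ge0_integralD//; try exact: mD; try exact: mclE; try (by apply: c0).
    apply: eq_integral => w _; rewrite /D -!EFinD; congr EFin.
    by case: (lerP (clamp n (B w) - clamp n (A w)) 0);
      case: (lerP (clamp n (A w) - clamp n (B w)) 0); lra.
  rewrite (_ : (\int[P]_w (clamp n (A w) + n%:R)%:E =
             \int[P]_w (clamp n (B w) + n%:R)%:E)%E); last first.
    apply: (@ge0_integral_same_law A B
      (fun x => (clamp n x + n%:R)%:E)) => //.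
      by apply/measurable_EFinP/measurable_funD => //; exact: measurable_clamp.
    by move=> x; rewrite lee_fin clamp_ge.
  set c := (\int[P]_w (clamp n (B w) + n%:R)%:E)%E => DE.
  suff cfin : c \is a fin_num by rewrite -[LHS](addeK _ cfin) DE addeK.
  rewrite ge0_fin_numE; last first.
    by apply: integral_ge0 => w _; rewrite lee_fin clamp_ge.
  apply: (@le_lt_trans _ _ (\int[P]_w (cst (n%:R + n%:R)%:E w))%E).
    apply: ge0_le_integral => //; [|exact: mclE|].
      by move=> w _; rewrite lee_fin clamp_ge.
    by move=> w _; rewrite lee_fin clamp_le.
  by rewrite integral_cst//= probability_setT mule1 ltry.
have limE C1 C2 : measurable_fun setT (C1 : Om -> T) ->
    measurable_fun setT (C2 : Om -> T) ->
    (\int[P]_w (Num.max (C2 w - C1 w) 0)%:E =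
     limn (fun n => \int[P]_w D C1 C2 n w))%E.
  move=> m1 m2; rewrite -monotone_convergence//; last 2 first.
  - by move=> n; exact: mD.
  - by move=> w _ m n mn; rewrite lee_fin clamp_diff_homo.
  apply: eq_integral => w _; apply/esym/cvg_lim => //.
  apply: (@cvg_trans _ ((Num.max (C2 w - C1 w) 0)%:E @[n --> \oo])%E).
    apply: near_eq_cvg; near=> n.
    have nbig : Num.max `|C1 w| `|C2 w| <= n%:R by near: n; exact: nbhs_infty_ger.
    move: nbig; rewrite ge_max => /andP[n1 n2].
    by rewrite /D !clamp_id.
  exact: cvg_cst.
rewrite (limE _ _ mA mB) (limE _ _ mB mA).
by congr (limn _); apply/funext => n; exact: intE.
Unshelve. all: by end_near. Qed.

End same_law.

(** * Transport inequality between equal laws *)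

Section exact_transport.
Context d (Om : measurableType d) {R : realType} (P : probability Om R).
Local Notation T := (measurableTypeR R).
Implicit Types (f : Om -> T).

Definition integral_defined (f : Om -> R) :=
  ((\int[P]_w (EFin \o f)^\+ w < +oo) \/ (\int[P]_w (EFin \o f)^\- w < +oo))%E.

Lemma funeposEFin (f : Om -> R) w :
  (EFin \o f)^\+%E w = (Num.max (f w) 0)%:E.
Proof. by rewrite funeposE /= EFin_max. Qed.

Lemma funenegEFin (f : Om -> R) w :
  (EFin \o f)^\-%E w = (Num.max (- f w) 0)%:E.
Proof. by rewrite funenegE /= EFin_max. Qed.

Lemma not_ltyE (x : \bar R) : (~ (x < +oo) -> x = +oo)%E.
Proof. by move=> /negP; rewrite -leNgt leye_eq => /eqP. Qed.

Lemma integrable_EFin_posneg f : measurable_fun setT f ->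
  (\int[P]_w (EFin \o f)^\+ w < +oo)%E ->
  (\int[P]_w (EFin \o f)^\- w < +oo)%E -> P.-integrable setT (EFin \o f).
Proof.
move=> mf fp fn; apply/integrableP; split; first exact/measurable_EFinP.
under eq_integral do rewrite -[(abse _)]/((abse \o (EFin \o f)) _) fune_abse.
rewrite ge0_integralD//=; first exact: lte_add_pinfty.
  by apply: measurable_funepos; exact/measurable_EFinP.
by apply: measurable_funeneg; exact/measurable_EFinP.
Qed.

Lemma ge0_integral_lty_addl (f1 f2 g : Om -> R) :
  measurable_fun setT (f1 : Om -> T) -> measurable_fun setT (f2 : Om -> T) ->
  measurable_fun setT (g : Om -> T) ->
  (forall w, 0 <= f1 w) -> (forall w, 0 <= f2 w) -> (forall w, 0 <= g w) ->
  (forall w, g w <= f1 w + f2 w) ->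
  (\int[P]_w (f1 w)%:E < +oo -> \int[P]_w (f2 w)%:E < +oo ->
   \int[P]_w (g w)%:E < +oo)%E.
Proof.
move=> m1 m2 mg f10 f20 g0 gle i1 i2.
apply: (@le_lt_trans _ _ (\int[P]_w ((f1 w)%:E + (f2 w)%:E))%E).
  apply: ge0_le_integral => //.
  - by move=> w _; rewrite lee_fin.
  - exact/measurable_EFinP.
  - by apply: emeasurable_funD; exact/measurable_EFinP.
  - by move=> w _; rewrite -EFinD lee_fin.
rewrite ge0_integralD//; first exact: lte_add_pinfty.
- by move=> w _; rewrite lee_fin.
- exact/measurable_EFinP.
- by move=> w _; rewrite lee_fin.
- exact/measurable_EFinP.
Qed.

Context (c e A B : Om -> T).
Hypotheses (mc : measurable_fun setT c) (me : measurable_fun setT e).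
Hypotheses (mA : measurable_fun setT A) (mB : measurable_fun setT B).
Hypothesis AB : same_law P A B.
Hypothesis le_c : forall w, e w + (B w - A w) <= c w.

(** [B - A <= c^+ + e^-] bounds the positive part of [B - A], hence its negative
part since [A] and [B] have the same law; the parts that remain then follow
from [e + (B - A) <= c]. *)
Lemma exact_transport_integrable :
  (\int[P]_w (EFin \o c)^\+ w < +oo)%E ->
  (\int[P]_w (EFin \o e)^\- w < +oo)%E ->
  [/\ P.-integrable setT (EFin \o c), P.-integrable setT (EFin \o e) &
      P.-integrable setT (EFin \o (B \- A)%R)].
Proof.
have posE (f : Om -> R) :
    (\int[P]_w (EFin \o f)^\+ w)%E = (\int[P]_w (Num.max (f w) 0)%:E)%E.
  by apply: eq_integral => w _; rewrite funeposEFin.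
have negE (f : Om -> R) :
    (\int[P]_w (EFin \o f)^\- w)%E = (\int[P]_w (Num.max (- f w) 0)%:E)%E.
  by apply: eq_integral => w _; rewrite funenegEFin.
have mp f : measurable_fun setT f ->
    measurable_fun setT (fun w => Num.max (f w) 0 : T).
  by move=> mf; exact: measurable_maxr.
have mn f : measurable_fun setT f ->
    measurable_fun setT (fun w => Num.max (- f w) 0 : T).
  by move=> mf; apply: measurable_maxr => //; exact: measurable_funN.
have p0 (x : R) : 0 <= Num.max x 0 by rewrite le_max lexx orbT.
have pl (x : R) : x <= Num.max x 0 by rewrite le_max lexx.
have mBA : measurable_fun setT (B \- A : Om -> T) by exact: measurable_funB.
rewrite posE negE => cp en.
have BAp : (\int[P]_w (Num.max ((B \- A) w) 0)%:E < +oo)%E.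
  apply: (ge0_integral_lty_addl (mp _ mc) (mn _ me)) => //; first exact: mp.
  move=> w /=; rewrite ge_max; apply/andP.
  move: (le_c w) (pl (c w)) (p0 (c w)) (pl (- e w)) (p0 (- e w)).
  by move=> *; split; lra.
have BAn : (\int[P]_w (Num.max (- (B \- A) w) 0)%:E < +oo)%E.
  have := BAp; rewrite integral_max0B_same_law//.
  by under eq_integral do rewrite -opprB.
have cn : (\int[P]_w (Num.max (- c w) 0)%:E < +oo)%E.
  apply: (ge0_integral_lty_addl (mn _ me) (mn _ mBA)) => //; first exact: mn.
  move=> w /=; rewrite ge_max; apply/andP.
  move: (le_c w) (pl (- e w)) (p0 (- e w)) (pl (- (B w - A w))) (p0 (- (B w - A w))).
  by move=> *; split; lra.
have ep : (\int[P]_w (Num.max (e w) 0)%:E < +oo)%E.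
  apply: (ge0_integral_lty_addl (mp _ mc) (mn _ mBA)) => //; first exact: mp.
  move=> w /=; rewrite ge_max; apply/andP.
  move: (le_c w) (pl (c w)) (p0 (c w)) (pl (- (B w - A w))) (p0 (- (B w - A w))).
  by move=> *; split; lra.
by split; apply: integrable_EFin_posneg; rewrite ?posE ?negE.
Qed.

Lemma integral_exact_transport : P.-integrable setT (EFin \o (B \- A)%R) ->
  (\int[P]_w (EFin \o (B \- A)%R) w = 0)%E.
Proof.
move=> iBA; rewrite integralE.
have -> : (\int[P]_w (EFin \o (B \- A)%R)^\- w =
           \int[P]_w (EFin \o (B \- A)%R)^\+ w)%E.
  under eq_integral do rewrite funenegEFin.
  under [RHS]eq_integral do rewrite funeposEFin/=.
  rewrite integral_max0B_same_law//.
  by apply: eq_integral => w _; rewrite /= opprB.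
by rewrite subee// integrable_pos_fin_num.
Qed.

(** Outside of the integrable case, the integral of [e] is [-oo] or that of [c] is
[+oo]. *)
Lemma integral_le_exact_transport : integral_defined e -> integral_defined c ->
  (\int[P]_w (e w)%:E <= \int[P]_w (c w)%:E)%E.
Proof.
rewrite /integral_defined => e_def c_def.
have [en|/not_ltyE en] := pselect (\int[P]_w (EFin \o e)^\- w < +oo)%E; last first.
  case: e_def => [ep|]; last by rewrite en.
  rewrite [leLHS]integralE [X in (_ - X <= _)%E]en.
  have : (\int[P]_w (EFin \o e)^\+ w \is a fin_num)%E.
    by rewrite ge0_fin_numE// integral_ge0.
  by move=> /fineK <-; rewrite leNye.
have [cp|/not_ltyE cp] := pselect (\int[P]_w (EFin \o c)^\+ w < +oo)%E; last first.
  case: c_def => [|cn]; first by rewrite cp.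
  rewrite [leRHS]integralE [X in (_ <= X - _)%E]cp.
  have : (\int[P]_w (EFin \o c)^\- w \is a fin_num)%E.
    by rewrite ge0_fin_numE// integral_ge0.
  by move=> /fineK <-; rewrite leey.
have [ic ie iBA] := exact_transport_integrable cp en.
rewrite -[leLHS]adde0 -(integral_exact_transport iBA) -integralD//.
apply: le_integral => //; first exact: integrableD.
by move=> w _; rewrite /= lee_fin le_c.
Qed.

Lemma exact_transport_ae_eq : integral_defined e -> integral_defined c ->
  (\int[P]_w (e w)%:E)%E \is a fin_num ->
  (\int[P]_w (c w)%:E <= \int[P]_w (e w)%:E)%E ->
  P [set w | c w != e w + (B w - A w)] = 0%E.
Proof.
move=> e_def c_def efin cle.
rewrite /integral_defined in e_def c_def.
have [en|/not_ltyE en] := pselect (\int[P]_w (EFin \o e)^\- w < +oo)%E; last first.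
  move: efin; rewrite [X in X \is a _]integralE [X in (_ - X)%E]en.
  by rewrite addeC.
have [cp|/not_ltyE cp] := pselect (\int[P]_w (EFin \o c)^\+ w < +oo)%E; last first.
  case: c_def => [|cn]; first by rewrite cp.
  move: cle; rewrite [leLHS]integralE [X in (X - _ <= _)%E]cp.
  have : (\int[P]_w (EFin \o c)^\- w \is a fin_num)%E.
    by rewrite ge0_fin_numE// integral_ge0.
  move=> /fineK <-; rewrite leye_eq => /eqP ey.
  by rewrite ey in efin.
have [ic ie iBA] := exact_transport_integrable cp en.
pose g := c \- (e \+ (B \- A)).
have mg : measurable_fun setT (EFin \o g : Om -> \bar R).
  apply/measurable_EFinP; apply: measurable_funB => //.
  by apply: measurable_funD => //; exact: measurable_funB.
have g0 w : (0 <= (EFin \o g) w)%E.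
  by rewrite lee_fin subr_ge0 le_c.
have : (\int[P]_w `|(EFin \o g) w| = 0)%E.
  under eq_integral do rewrite gee0_abs//.
  apply/eqP; rewrite eq_le integral_ge0 ?andbT//.
  have -> : (\int[P]_w (EFin \o g) w = \int[P]_w (c w)%:E -
      (\int[P]_w (e w)%:E + \int[P]_w (EFin \o (B \- A)%R) w))%E.
    rewrite -integralD// -integralB//; last exact: integrableD.
  by rewrite integral_exact_transport// adde0 sube_le0.
move=> /(ae_eq_integral_abs _ measurableT mg)[N [mN N0 subN]].
apply: (subset_measure0 _ mN _ N0).
  have -> : [set w | c w != e w + (B w - A w)] = (EFin \o g) @^-1` ~` [set 0%E].
    apply/seteqP; split => w /=.
      by move=> /eqP ne; rewrite /g /= => -[/subr0_eq].
    by move=> ne; apply/eqP => ce; apply: ne; rewrite /g /= ce subrr.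
  by rewrite -[X in measurable X]setTI; apply: mg => //; exact: measurableC.
move=> w /= /eqP ne; apply: subN => /= /(_ I) [/subr0_eq].
exact: ne.
Qed.

End exact_transport.

(** * Laws, products and quantiles *)

Section laws.
Context {R : realType}.
Local Notation T := (measurableTypeR R).

Lemma preimage_measurable d1 d2 (X : measurableType d1) (Y : measurableType d2)
    (f : X -> Y) (A : set Y) :
  measurable_fun setT f -> measurable A -> measurable (f @^-1` A).
Proof. by move=> mf mA; rewrite -[X in measurable X]setTI; exact: mf. Qed.

Lemma probability_eq_mod_null d (X : measurableType d) (P : probability X R)
    (N S1 S2 : set X) : measurable N -> measurable S1 -> measurable S2 ->
  P N = 0%E -> (forall x, ~ N x -> (S1 x <-> S2 x)) -> P S1 = P S2.
Proof.
move=> mN m1 m2 N0 S12.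
have le (A B : set X) : measurable A -> measurable B ->
    (forall x, ~ N x -> A x -> B x) -> (P A <= P B)%E.
  move=> mA mB AB; apply: (@le_trans _ _ (P (B `|` N))).
    apply: le_measure; rewrite ?inE//; first exact: measurableU.
    move=> x Ax; have [Nx|Nx] := pselect (N x); first by right.
    by left; exact: AB.
  by rewrite (le_trans (measureU2 _ _ _))// [X in (_ + X)%E]N0 adde0.
by apply/eqP; rewrite eq_le; apply/andP; split; apply: le => // x /S12[].
Qed.

Lemma same_measure_rays (m1 m2 : probability T R) :
  (forall x, m1 `]-oo, x]%classic = m2 `]-oo, x]%classic) -> same_measure m1 m2.
Proof.
move=> m12 A mA.
have GT : RGenOInfty.G (R:=R) `<=` @measurable _ T.
  by move=> _ [x ->]; exact: measurable_itv.
pose g n : set T := `](- n%:R), +oo[%classic.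
have Gg n : RGenOInfty.G (R:=R) (g n) by exists (- n%:R).
have g_cover : \bigcup_k g k = setT.
  apply/seteqP; split => // x _; exists (Num.truncn `|x|).+1 => //=.
  rewrite /g/= in_itv/= andbT ltrNl (le_lt_trans (ler_norm _))// normrN.
  exact: truncnS_gt.
apply: (@g_sigma_algebra_measure_unique _ R T _ GT g Gg g_cover m1 m2).
- move=> _ _ [x ->] [y ->]; exists (Num.max x y).
  by apply/seteqP; split => z /=; rewrite !in_itv/= !andbT gt_max => /andP.
- move=> _ [x ->]; have corayE (m : probability T R) :
      m `]x, +oo[%classic = (1 - m `]-oo, x]%classic)%E.
    by rewrite -setCitvl probability_setC//; exact: measurable_itv.
  by apply: etrans (corayE m1) (etrans _ (esym (corayE m2))); rewrite m12.
- move=> n; rewrite (le_lt_trans (probability_le1 _ _)) ?ltry//.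
  exact: measurable_itv.
- have <- : @measurable _ T = <<s RGenOInfty.G (R:=R) >> by exact: RGenOInfty.measurableE.
  exact: mA.
Qed.

Lemma product_law d1 d2 (X : measurableType d1) (Y : measurableType d2)
    (P : probability X R) (Q : probability Y R) (f : X -> Y) :
  measurable_fun setT f ->
  (forall A, measurable A -> Q A = P (f @^-1` A)) ->
  forall S, measurable S ->
    (Q \x Q)%E S = (P \x P)%E ((fun z => (f z.1, f z.2)) @^-1` S).
Proof.
move=> mf QP S mS.
pose ff (z : X * X) := (f z.1, f z.2).
have mff : measurable_fun setT ff.
  by apply: measurable_fun_pair; exact: measurableT_comp.
pose ff_mfun : {mfun (X * X)%type >-> (Y * Y)%type} := HB.pack ff
  (@isMeasurableFun.Build _ _ _ _ ff mff).
apply: (product_measure_unique (m' := distribution (P \x P)%E ff_mfun)) => // A B mA mB.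
have <- : (P \x P)%E ((f @^-1` A) `*` (f @^-1` B)) = (Q A * Q B)%E.
  by rewrite product_measure1E ?QP//; exact: preimage_measurable.
by [].
Qed.

End laws.

Section quantiles.
Context {R : realType}.
Local Notation T := (measurableTypeR R).
Implicit Types mu nu : probability T R.

Let idT : T -> R := idfun.
#[local] HB.instance Definition _ :=
  @isMeasurableFun.Build _ _ _ _ idT (@measurable_id _ _ setT).

(** The infimum that defines the quantile is attained, because distribution
functions are right-continuous. *)
Lemma quantile_le mu (t x : R) : 0 < t < 1 ->
  (quantile mu t <= x) = (t%:E <= mu `]-oo, x]%classic)%E.
Proof.
move=> /andP[t0 t1]; apply/idP/idP => [qx|tx]; last first.
  by apply: ge_inf => //; exact: quantile_set_lbound.
rewrite leNgt; apply/negP => xt.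
have := @cdf_right_continuous _ _ _ mu (idT : {RV mu >-> R}) x.
move=> /(_ [set y : \bar R | y < t%:E]%E) [].
  by apply: open_nbhs_nbhs; split; first exact: open_ereal_lt_ereal.
move=> e /= e0 /(_ (x + e / 2)) /=.
rewrite opprD addrA subrr sub0r normrN gtr0_norm; last by rewrite divr_gt0.
rewrite gtr_pMr// invf_lt1// ltr1n => /(_ isT).
rewrite ltrDl divr_gt0// => /(_ isT) xe.
suff : x + e / 2 <= quantile mu t.
  by move=> /le_trans/(_ qx); rewrite leNgt ltrDl divr_gt0.
apply: lb_le_inf; first exact: quantile_set_nonempty.
move=> y /= ty; rewrite leNgt; apply/negP => yx.
have : (mu `]-oo, y]%classic <= mu `]-oo, (x + e / 2)%R]%classic)%E.
  by apply: le_measure; rewrite ?inE//; try exact: measurable_itv;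
    apply: subset_itvl; rewrite bnd_simp ltW.
by move=> /(le_trans ty); rewrite leNgt => /negP; apply.
Qed.

Local Notation unif := (uniform_prob (@ltr01 R)).

Lemma uniform01E (S : set T) : measurable S ->
  unif S = lebesgue_measure (S `&` `[0%R, 1%R]).
Proof.
move=> mS; rewrite /uniform_prob integral_uniform_pdf.
have mS1 : measurable (S `&` `[0%R, 1%R]).
  by apply: measurableI => //; exact: measurable_itv.
rewrite (eq_integral (cst 1%E)); first by rewrite integral_cst//= mul1e.
move=> x; rewrite inE => -[_ /=]; rewrite in_itv/= => x01.
by rewrite /uniform_pdf x01 subr0 invr1.
Qed.

Lemma uniform01_ray (p : R) : 0 <= p <= 1 -> unif `]-oo, p]%classic = p%:E.
Proof.
move=> /andP[p0 p1]; rewrite uniform01E; last exact: measurable_itv.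
have -> : `]-oo, p] `&` `[0%R, 1%R] = `[0%R, p]%classic.
  apply/seteqP; split => x /=; rewrite !in_itv/=.
    by move=> [xp /andP[x0 _]]; rewrite x0.
  by move=> /andP[x0 xp]; split; rewrite // x0 (le_trans xp p1).
rewrite lebesgue_measure_itv/= lte_fin; case: ltgtP p0 => // [_ _|<- _].
  by rewrite oppr0 adde0.
by [].
Qed.

Lemma uniform01_coray (p : R) : 0 <= p <= 1 ->
  unif `[(1 - p), +oo[%classic = p%:E.
Proof.
move=> /andP[p0 p1]; rewrite uniform01E; last exact: measurable_itv.
have -> : `[(1 - p), +oo[ `&` `[0%R, 1%R] = `[(1 - p), 1%R]%classic.
  apply/seteqP; split => x /=; rewrite !in_itv/= !andbT.
    by move=> [xp /andP[_ x1]]; rewrite xp.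
  by move=> /andP[xp x1]; split; rewrite // x1 andbT; move: xp p1; lra.
rewrite lebesgue_measure_itv/= lte_fin.
move: p0; rewrite le_eqVlt => /predU1P[<-|p0]; first by rewrite subr0 ltxx.
rewrite ifT; last lra.
by rewrite -EFinD; congr EFin; lra.
Qed.

Lemma uniform01_boundary : unif (~` `]0%R, 1%R[%classic) = 0%E.
Proof.
rewrite uniform01E; last by apply: measurableC; exact: measurable_itv.
have -> : (~` `]0%R, 1%R[%classic) `&` `[0%R, 1%R]%classic =
    [set 0%R] `|` [set 1%R] :> set T.
  apply/seteqP; split => x /=; rewrite !in_itv/=.
    move=> [/negP + /andP[x0 x1]]; rewrite negb_and -!leNgt => /orP[x0'|x1'].
      by left; apply/eqP; rewrite eq_le x0' x0.
    by right; apply/eqP; rewrite eq_le x1' x1.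
  by case=> ->; rewrite ?ltxx ?lexx ?ler01 ?andbF//.
apply/eqP; rewrite eq_le measure_ge0 andbT.
apply: (le_trans (measureU2 _ _ _)); [exact: measurable_set1..|].
rewrite [X in (X + _ <= _)%E]lebesgue_measure_set1.
by rewrite [X in (_ + X <= _)%E]lebesgue_measure_set1 adde0.
Qed.

(** The points [0] and [1] are null; this discards the levels at which a quantile
has no meaning. *)
Lemma uniform01_eq (S1 S2 : set T) : measurable S1 -> measurable S2 ->
  (forall t, 0 < t < 1 -> (S1 t <-> S2 t)) -> unif S1 = unif S2.
Proof.
move=> m1 m2 S12.
apply: (probability_eq_mod_null _ m1 m2 uniform01_boundary).
  by apply: measurableC; exact: measurable_itv.
by move=> t /contrapT /=; rewrite in_itv/=; exact: S12.
Qed.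

Lemma probability_rayE mu x :
  exists2 p : R, 0 <= p <= 1 & mu `]-oo, x]%classic = p%:E.
Proof.
have fin : mu `]-oo, x]%classic \is a fin_num.
  by apply: fin_num_measure; exact: measurable_itv.
exists (fine (mu `]-oo, x]%classic)); last by rewrite fineK.
by rewrite -!lee_fin fineK// measure_ge0 probability_le1.
Qed.

Lemma law_quantile mu (A : set T) : measurable A ->
  unif (quantile mu @^-1` A) = mu A.
Proof.
pose q : {mfun T >-> T} := HB.pack (quantile mu : T -> T)
  (@isMeasurableFun.Build _ _ _ _ (quantile mu : T -> T) (measurable_quantile mu)).
apply: (same_measure_rays (m1 := distribution unif q)) => x.
have [p p01 px] := probability_rayE mu x.
rewrite px -(uniform01_ray p01); apply: uniform01_eq.
- by apply: preimage_measurable; [exact: measurable_quantile|exact: measurable_itv].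
- exact: measurable_itv.
- by move=> t t01 /=; rewrite !in_itv/= quantile_le// px lee_fin.
Qed.

Lemma law_quantile_onem mu (A : set T) : measurable A ->
  unif ((fun t => quantile mu (1 - t)) @^-1` A) = mu A.
Proof.
have mq : measurable_fun setT ((fun t => quantile mu (1 - t)) : T -> T).
  apply: (measurableT_comp (measurable_quantile mu)) => /=.
  exact: measurable_funB.
pose q : {mfun T >-> T} := HB.pack ((fun t => quantile mu (1 - t)) : T -> T)
  (@isMeasurableFun.Build _ _ _ _ _ mq).
apply: (same_measure_rays (m1 := distribution unif q)) => x.
have [p p01 px] := probability_rayE mu x.
rewrite px -(uniform01_coray p01); apply: uniform01_eq.
- by apply: preimage_measurable; [exact: mq|exact: measurable_itv].
- exact: measurable_itv.
- move=> t t01 /=; rewrite !in_itv/= andbT quantile_le//; last by move: t01; lra.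
  by rewrite px lee_fin; split; lra.
Qed.

End quantiles.

(** * Monotone couplings of a law and its affine image *)

Section affine_couplings.
Context {R : realType}.
Local Notation T := (measurableTypeR R).
Implicit Types mu nu : probability T R.
Local Notation unif := (uniform_prob (@ltr01 R)).

Definition has_law d1 d2 (X : measurableType d1) (Y : measurableType d2)
    (P : probability X R) (f : X -> Y) (Q : probability Y R) :=
  forall A, measurable A -> Q A = P (f @^-1` A).

Definition affine (a b x : R) : R := a * x + b.

Definition affine_graph (a b : R) (x : T) : T * T := (x, affine a b x).

Lemma measurable_affine a b : measurable_fun setT (affine a b : T -> T).
Proof. by apply: measurable_funD => //; exact: measurable_funM. Qed.

Lemma measurable_affine_graph a b : measurable_fun setT (affine_graph a b).
Proof. by apply: measurable_fun_pair => //; exact: measurable_affine. Qed.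

Lemma quantile_affine mu nu a b t : 0 < a -> has_law mu (affine a b : T -> T) nu ->
  0 < t < 1 -> quantile nu t = affine a b (quantile mu t).
Proof.
move=> a0 munu t01.
have qE x : (quantile nu t <= x) = (affine a b (quantile mu t) <= x).
  rewrite quantile_le// munu; last exact: measurable_itv.
  have -> : affine a b @^-1` `]-oo, x]%classic = `]-oo, (x - b) / a]%classic.
    apply/seteqP; split => y /=; rewrite !in_itv/= /affine ler_pdivlMr//; lra.
  rewrite -quantile_le// ler_pdivlMr// /affine.
  by apply/idP/idP; lra.
by apply/eqP; rewrite eq_le qE lexx -qE lexx.
Qed.

(** Only an inequality: the two sides differ where the distribution function of
[mu] is flat, at the level [t]. *)
Lemma quantile_onem_affine_le mu nu a b t : a < 0 ->
  has_law mu (affine a b : T -> T) nu ->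
  0 < t < 1 -> quantile nu (1 - t) <= affine a b (quantile mu t).
Proof.
move=> a0 munu t01; have t01' : 0 < 1 - t < 1 by lra.
have lez z : z < quantile mu t -> quantile nu (1 - t) <= affine a b z.
  rewrite ltNge => zt; rewrite quantile_le// -ltNge in zt.
  rewrite quantile_le// munu; last exact: measurable_itv.
  have [p p01 pz] := probability_rayE mu z; rewrite pz lte_fin in zt.
  apply: (@le_trans _ _ (1 - p)%:E); first by rewrite lee_fin; lra.
  have -> : ((1 - p)%:E = mu (~` `]-oo, z]%classic))%E.
    by rewrite probability_setC ?pz//; exact: measurable_itv.
  apply: le_measure; rewrite ?inE.
  - by apply: measurableC; exact: measurable_itv.
  - by apply: preimage_measurable; [exact: measurable_affine|exact: measurable_itv].
  - by move=> y /= /negP; rewrite !in_itv/= -ltNge /affine => zy; nra.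
rewrite leNgt; apply/negP => lt_q.
pose y := (quantile nu (1 - t) - b) / a.
have yE : quantile nu (1 - t) = a * y + b.
  by rewrite /y mulrC divfK ?lt_eqF// subrK.
rewrite yE /affine in lez lt_q.
have yq : y < quantile mu t by nra.
have /lez : (y + quantile mu t) / 2 < quantile mu t by lra.
by nra.
Qed.

Lemma measurable_neq_set d (Om : measurableType d) (A B : Om -> T) :
  measurable_fun setT A -> measurable_fun setT B ->
  measurable [set w | A w != B w].
Proof.
move=> mA mB.
have -> : [set w | A w != B w] = (fun w => A w - B w) @^-1` (~` [set 0]).
  apply/seteqP; split => w /=; rewrite -subr_eq0; first by move/eqP.
  by move=> ne; apply/eqP.
apply: (@preimage_measurable _ _ _ T); first exact: measurable_funB.
by apply: measurableC; exact: measurable_set1.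
Qed.

(** The integral of the positive part of [A - B] vanishes, hence so does that of
[B - A], by [integral_max0B_same_law]. *)
Lemma same_law_le_eq d (Om : measurableType d) (P : probability Om R)
    (A B : Om -> T) (N : set Om) :
  measurable_fun setT A -> measurable_fun setT B -> same_law P A B ->
  measurable N -> P N = 0%E -> (forall w, ~ N w -> A w <= B w) ->
  P [set w | A w != B w] = 0%E.
Proof.
move=> mA mB AB mN N0 leAB.
have mmax (C D : Om -> T) : measurable_fun setT C -> measurable_fun setT D ->
    measurable_fun setT (fun w => (Num.max (C w - D w) 0)%:E).
  move=> mC mD; apply/measurable_EFinP; apply: measurable_maxr => //.
  exact: measurable_funB.
have : (\int[P]_w (Num.max (A w - B w) 0)%:E = 0)%E.
  rewrite (ae_eq_integral (cst 0%E))//; first by rewrite integral0.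
    exact: mmax.
  exists N; split => // w /= /not_implyP[_ ne]; apply: contrapT => /leAB le.
  by apply: ne; rewrite max_r// subr_le0.
rewrite integral_max0B_same_law//; last by move=> S mS; rewrite AB.
move=> int0.
have : (\int[P]_w `|(Num.max (B w - A w) 0)%:E| = 0)%E.
  rewrite -[RHS]int0; apply: eq_integral => w _.
  by rewrite gee0_abs// lee_fin le_max lexx orbT.
move=> /(ae_eq_integral_abs _ measurableT (mmax _ _ mB mA))[M [mM M0 subM]].
have NM0 : P (N `|` M) = 0%E.
  apply/eqP; rewrite eq_le measure_ge0 andbT.
  rewrite (le_trans (measureU2 _ mN mM))//.
  by rewrite [X in (X + _ <= _)%E]N0 [X in (_ + X <= _)%E]M0 adde0.
apply: (subset_measure0 _ (measurableU _ _ mN mM) _ NM0).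
  exact: measurable_neq_set.
move=> w /= ne; have [Nw|/leAB le] := pselect (N w); [by left|right].
apply: subM => /= /(_ I)[]; rewrite max_l ?subr_ge0//.
by move=> /subr0_eq BA; rewrite BA eqxx in ne.
Qed.

Lemma pi_com_affine mu nu a b : 0 < a -> has_law mu (affine a b : T -> T) nu ->
  has_law mu (affine_graph a b) (pi_com mu nu).
Proof.
move=> a0 munu S mS.
have mgS : measurable (affine_graph a b @^-1` S).
  by apply: preimage_measurable mS; exact: measurable_affine_graph.
rewrite -law_quantile//; apply: uniform01_eq.
- by apply: preimage_measurable mS; exact: measurable_com_map.
- by apply: preimage_measurable mgS; exact: measurable_quantile.
- by move=> t t01; rewrite /= /com_map (quantile_affine a0 munu t01).
Qed.

(** Both sides of [quantile_onem_affine_le] have law [nu] under the uniform law, so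
that they are almost surely equal. *)
Lemma pi_ant_affine mu nu a b : a < 0 -> has_law mu (affine a b : T -> T) nu ->
  has_law mu (affine_graph a b) (pi_ant mu nu).
Proof.
move=> a0 munu S mS.
have mgS : measurable (affine_graph a b @^-1` S).
  by apply: preimage_measurable mS; exact: measurable_affine_graph.
have mA : measurable_fun setT ((fun t => quantile nu (1 - t)) : T -> T).
  apply: (measurableT_comp (measurable_quantile nu)) => /=.
  exact: measurable_funB.
have mB : measurable_fun setT (affine a b \o quantile mu : T -> T).
  apply: measurableT_comp (measurable_quantile mu); exact: measurable_affine.
have mbd : measurable (~` `]0%R, 1%R[%classic : set T).
  by apply: measurableC; exact: measurable_itv.
pose NE := [set t | quantile nu (1 - t) != (affine a b \o quantile mu) t].
have mNE : measurable (NE : set T) by exact: measurable_neq_set.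
have NE0 : unif NE = 0%E.
  apply: (same_law_le_eq mA mB _ mbd uniform01_boundary).
    move=> A mA'; apply: (etrans (law_quantile_onem nu mA')); rewrite munu//.
    apply/esym; apply: (law_quantile mu).
    by apply: preimage_measurable mA'; exact: measurable_affine.
  move=> t /contrapT /=; rewrite in_itv/=.
  exact: quantile_onem_affine_le.
rewrite -law_quantile//.
apply: (probability_eq_mod_null mNE) => //.
- by apply: preimage_measurable mS; exact: measurable_ant_map.
- by apply: preimage_measurable mgS; exact: measurable_quantile.
- move=> t; rewrite /NE /= => /negP; rewrite negbK => /eqP tE.
  by rewrite /ant_map tE.
Qed.

End affine_couplings.

(** * Rigidity of almost sure isometries *)

Section pushforward_product.
Context {R : realType}.
Local Notation T := (measurableTypeR R).

Lemma ge0_integral_product_law d1 d2 (X : measurableType d1)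
    (Y : measurableType d2) (P : probability X R) (Q : probability Y R)
    (f : X -> Y) (F : Y * Y -> \bar R) :
  measurable_fun setT f -> has_law P f Q ->
  measurable_fun setT F -> (forall z, 0 <= F z)%E ->
  (\int[Q \x Q]_z F z = \int[P \x P]_z F (f z.1, f z.2))%E.
Proof.
move=> mf PQ mF F0.
pose ff (z : X * X) := (f z.1, f z.2).
have mff : measurable_fun setT ff.
  by apply: measurable_fun_pair; exact: measurableT_comp.
transitivity (\int[pushforward (P \x P)%E ff]_z F z)%E.
  by apply: eq_measure_integral => S mS _; exact: (product_law mf PQ mS).
by rewrite ge0_integral_pushforward// preimage_setT.
Qed.

Lemma integral_product_law d1 d2 (X : measurableType d1)
    (Y : measurableType d2) (P : probability X R) (Q : probability Y R)
    (f : X -> Y) (F : Y * Y -> T) :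
  measurable_fun setT f -> has_law P f Q -> measurable_fun setT F ->
  (\int[Q \x Q]_z (F z)%:E = \int[P \x P]_z (F (f z.1, f z.2))%:E)%E /\
  (integral_defined (Q \x Q)%E F <->
   integral_defined (P \x P)%E (fun z => F (f z.1, f z.2))).
Proof.
move=> mf PQ mF; have mEF : measurable_fun setT (EFin \o F : _ -> \bar R).
  exact/measurable_EFinP.
pose ff (z : X * X) := (f z.1, f z.2).
have posE : (\int[Q \x Q]_z (EFin \o F)^\+ z =
    \int[P \x P]_z ((EFin \o F) \o ff)^\+ z)%E.
  rewrite (ge0_integral_product_law mf PQ (measurable_funepos mEF))//.
  by rewrite (funepos_comp (EFin \o F) ff).
have negE : (\int[Q \x Q]_z (EFin \o F)^\- z =
    \int[P \x P]_z ((EFin \o F) \o ff)^\- z)%E.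
  rewrite (ge0_integral_product_law mf PQ (measurable_funeneg mEF))//.
  by rewrite (funeneg_comp (EFin \o F) ff).
split; last by rewrite /integral_defined posE negE.
by rewrite [LHS]integralE [RHS]integralE [X in (X - _)%E]posE [X in (_ - X)%E]negE.
Qed.

Lemma product_law_same_law d1 (X : measurableType d1)
    (P : probability X R) (mu : probability T R) (f g : X -> T)
    (D : T * T -> T) :
  measurable_fun setT f -> measurable_fun setT g -> measurable_fun setT D ->
  has_law P f mu -> has_law P g mu ->
  same_law (P \x P)%E (fun z => D (f z.1, f z.2)) (fun z => D (g z.1, g z.2)).
Proof.
move=> mf mg mD Pf Pg S mS.
have mDS : measurable (D @^-1` S) by exact: preimage_measurable.
exact: etrans (esym (product_law mf Pf mDS)) (product_law mg Pg mDS).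
Qed.

End pushforward_product.

Section isometry_rigidity.
Context {R : realType} d (Om : measurableType d) (P : probability Om R).
Local Notation T := (measurableTypeR R).

Lemma null_set_exists_notin (S : set Om) : measurable S ->
  P S = 0%E -> exists w, ~ S w.
Proof.
move=> mS S0; apply: contrapT => noS.
have : P setT = 0%E.
  by rewrite (_ : setT = S)//; apply/seteqP; split => // w _;
    apply: contrapT => nS; apply: noS; exists w.
by rewrite probability_setT => /eqP; rewrite onee_eq0.
Qed.

Lemma product_null_section (N : set (Om * Om)) : measurable N ->
  (P \x P)%E N = 0%E -> exists w, P (xsection N w) = 0%E.
Proof.
move=> mN N0.
have mF : measurable_fun setT (P \o xsection N) by exact: measurable_fun_xsection.
have : (\int[P]_w `|(P \o xsection N) w| = 0)%E.
  by under eq_integral do rewrite gee0_abs ?measure_ge0//.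
move=> /(ae_eq_integral_abs _ measurableT mF)[M [mM M0 subM]].
have [w nMw] := null_set_exists_notin mM M0.
by exists w; apply: contrapT => ne; apply: nMw; apply: subM => /= /(_ I).
Qed.

(** Fix [w0] such that the hypothesis holds for almost all pairs [(w0, w)].  Then
[w] almost surely lies on one of the two lines [Z - Z w0 = X - X w0] and
[Z - Z w0 = - (X - X w0)].  Two points, one off each line, hence each on the
other line, are not at equal distances in [X] and in [Z].  So the product of
the masses off the two lines is zero. *)
Lemma isometric_ae (X Z : Om -> T) :
  measurable_fun setT X -> measurable_fun setT Z ->
  (P \x P)%E [set w | `|X w.1 - X w.2| != `|Z w.1 - Z w.2| ] = 0%E ->
  (exists s, P [set w | Z w != X w + s] = 0%E) \/
  (exists m, P [set w | Z w != m - X w] = 0%E).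
Proof.
move=> mX mZ; set N := [set w | _] => N0.
have mdist (f : Om -> T) : measurable_fun setT f ->
    measurable_fun setT (fun w : Om * Om => `|f w.1 - f w.2| : T).
  move=> mf; apply: (measurableT_comp (@normr_measurable R setT)).
  by apply: measurable_funB; exact: measurableT_comp.
have mN : measurable N by apply: measurable_neq_set; exact: mdist.
have [w0 S0] := product_null_section mN N0.
have mS : measurable (xsection N w0) by exact: measurable_xsection.
set S := xsection N w0 in S0 mS.
have Sout w : ~ S w -> Z w = X w + (Z w0 - X w0) \/ Z w = X w0 + Z w0 - X w.
  move=> nS; have : `|X w0 - X w| = `|Z w0 - Z w|.
    apply/eqP; rewrite -[_ == _]negbK; apply/negP => ne; apply: nS.
    by rewrite /S /xsection /= inE.
  by move=> /eqP; rewrite eqr_norm2 => /orP[]/eqP E; [left|right]; lra.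
pose Bp := [set w | Z w != X w + (Z w0 - X w0)] `\` S.
pose Bm := [set w | Z w != X w0 + Z w0 - X w] `\` S.
have mp : measurable [set w | Z w != X w + (Z w0 - X w0)].
  by apply: measurable_neq_set => //; exact: measurable_funD.
have mm : measurable [set w | Z w != X w0 + Z w0 - X w].
  by apply: measurable_neq_set => //; exact: measurable_funB.
have mBp : measurable Bp by exact: measurableD.
have mBm : measurable Bm by exact: measurableD.
have subN : Bp `*` Bm `<=` N.
  move=> [w w'] [/= [/eqP wp /Sout wS] [/eqP wm /Sout w'S]].
  rewrite /N /=; apply/negP; rewrite eqr_norm2 => E.
  by case: wS => // wE; case: w'S => // w'E; case/orP: E => /eqP; lra.
have : (P Bp * P Bm)%E = 0%E.
  rewrite -(product_measure1E P P)//.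
  by apply: (subset_measure0 _ mN subN N0); exact: measurableX.
have mod_null_section B : measurable B -> P (B `\` S) = 0%E -> P B = 0%E.
  move=> mB <-; apply: (probability_eq_mod_null mS) => //.
    exact: measurableD.
  by move=> w nSw; split => [Bw|[]//]; split.
move=> /eqP; rewrite mule_eq0 => /orP[]/eqP B0; [left|right].
  by exists (Z w0 - X w0); exact: mod_null_section.
by exists (X w0 + Z w0); exact: mod_null_section.
Qed.

End isometry_rigidity.

(** * Optimality for affine couplings *)

Section affine_optimality.
Context {R : realType}.
Local Notation T := (measurableTypeR R).
Variables (mu nu : probability T R) (h : R -> R -> R) (a b : R).
Hypotheses (a_neq0 : a != 0) (munu : has_law mu (affine a b : T -> T) nu).
Hypothesis h_meas : measurable_cost (abs_diff_cost h).
Local Notation c := (abs_diff_cost h).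

Definition affine_inv (p : T * T) : T := (p.2 - b) / a.

Definition rescaled (u v : R) : R := h u (`|a| * v).

Let C (z : (T * T) * (T * T)) : T := c z.1.1 z.1.2 z.2.1 z.2.2.
Let dist (w : T * T) : T := `|w.1 - w.2|.
(** The potential of [rescaled] at [|v|]; the absolute value lets its
measurability follow from that of the cost. *)
Let g (v : T) : T := h 0 (`|a| * `|v|) - sup_chain rescaled v.

Let a_gt0 : 0 < `|a|. Proof. by rewrite normr_gt0. Qed.

Lemma rescaled_submodular : submodular h -> submodular rescaled.
Proof.
move=> hs u u' v v' u0 v0 uu' vv'; apply: hs => //.
  by rewrite mulr_ge0.
by rewrite ltr_pM2l.
Qed.

Lemma rescaled_strictly_submodular :
  strictly_submodular h -> strictly_submodular rescaled.
Proof.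
move=> hs u u' v v' u0 v0 uu' vv'; apply: hs => //.
  by rewrite mulr_ge0.
by rewrite ltr_pM2l.
Qed.

Lemma measurable_affine_inv : measurable_fun setT affine_inv.
Proof. by apply: measurable_funM => //; exact: measurable_funB. Qed.

Let measurable_dist : measurable_fun setT dist.
Proof.
by apply: (measurableT_comp (@normr_measurable R setT)); exact: measurable_funB.
Qed.

Lemma affine_graph_coupling (Q : probability (T * T)%type R) :
  has_law mu (affine_graph a b) Q -> coupling mu nu Q.
Proof.
move=> muQ; split => A mA.
  rewrite muQ; last exact: measurableX.
  by congr (mu _); apply/seteqP; split => x //= -[].
rewrite muQ; last exact: measurableX.
rewrite munu//.
by congr (mu _); apply/seteqP; split => x //= -[].
Qed.

Section one_coupling.
Variables pi : probability (T * T)%type R.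
Hypothesis pi_coupling : coupling mu nu pi.

Lemma coupling_law_fst : has_law pi fst mu.
Proof.
move=> A mA; rewrite -pi_coupling.1//.
by congr (pi _); apply/seteqP; split => x //= -[].
Qed.

Lemma coupling_law_affine_inv : has_law pi affine_inv mu.
Proof.
move=> A mA.
have mB : measurable ((fun y : T => (y - b) / a : T) @^-1` A).
  apply: preimage_measurable mA.
  by apply: measurable_funM => //; exact: measurable_funB.
transitivity (nu ((fun y : T => (y - b) / a : T) @^-1` A)).
  rewrite munu//; congr (mu _); apply/seteqP.
  by split => x /=; rewrite /affine addrK mulrAC mulfV// mul1r.
rewrite -pi_coupling.2//; congr (pi _).
by apply/seteqP; split => x //= -[].
Qed.

Let U (z : (T * T) * (T * T)) : T := dist (fst z.1, fst z.2).
Let V (z : (T * T) * (T * T)) : T := dist (affine_inv z.1, affine_inv z.2).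

Let P : probability ((T * T) * (T * T))%type R := (pi \x pi)%E.

Let graph_fst (p : T * T) : T * T := affine_graph a b p.1.
(** The cost of the law of [(X, a X + b)], as a random variable under [pi]. *)
Let E (z : (T * T) * (T * T)) : T := C (graph_fst z.1, graph_fst z.2).

Let measurable_graph_fst : measurable_fun setT graph_fst.
Proof. by apply: (measurableT_comp (@measurable_affine_graph R a b)). Qed.

Let CE z : C z = rescaled (U z) (V z).
Proof.
rewrite /C /abs_diff_cost /rescaled /U /V /dist /affine_inv /=.
by rewrite -mulrBl opprB addrA subrK normrM normfV mulrCA mulfV ?mulr1 ?gt_eqF.
Qed.

Let EE z : E z = rescaled (U z) (U z).
Proof.
rewrite /E /C /abs_diff_cost /rescaled /U /dist /= /affine.
by rewrite opprD addrACA subrr addr0 -mulrBr normrM.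
Qed.

Let measurable_E : measurable_fun setT E.
Proof.
apply: (measurableT_comp h_meas).
by apply: measurable_fun_pair; exact: measurableT_comp.
Qed.

Let measurable_g : submodular h -> measurable_fun setT g.
Proof.
move=> hs; apply: measurable_funB.
  have -> : (fun v : T => h 0 (`|a| * `|v|) : T) =
      (fun v : T => C ((0, a * v), (0, 0))).
    by apply/funext => v; rewrite /C /abs_diff_cost /= !subr0 normr0 normrM.
  apply: (measurableT_comp h_meas).
  by apply: measurable_fun_pair => //; apply: measurable_fun_pair.
apply: nondecreasing_measurable => //.
by apply: sup_chain_nondecreasing; exact: rescaled_submodular.
Qed.

Let gE v : 0 <= v -> g v = diag_potential rescaled v.
Proof. by move=> v0; rewrite /g /diag_potential (ger0_norm v0). Qed.

Let same_law_gUV : submodular h -> same_law P (g \o U) (g \o V).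
Proof.
move=> hs; apply: (product_law_same_law (mu := mu) (D := g \o dist)).
- by [].
- exact: measurable_affine_inv.
- exact: measurableT_comp (measurable_g hs) measurable_dist.
- exact: coupling_law_fst.
- exact: coupling_law_affine_inv.
Qed.

Let measurable_U : measurable_fun setT U.
Proof.
apply: (measurableT_comp measurable_dist).
by apply: measurable_fun_pair; exact: measurableT_comp.
Qed.

Let measurable_V : measurable_fun setT V.
Proof.
apply: (measurableT_comp measurable_dist).
by apply: measurable_fun_pair; apply: measurableT_comp => //;
  exact: measurable_affine_inv.
Qed.

Let le_C : submodular h ->
  forall z, E z + ((g \o V) z - (g \o U) z) <= C z.
Proof.
move=> hs z; rewrite EE CE /= !gE ?normr_ge0//.
by apply: diag_potential_le; rewrite ?normr_ge0//; exact: rescaled_submodular.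
Qed.

Variables Q : probability (T * T)%type R.
Hypothesis Q_law : has_law mu (affine_graph a b) Q.

Let graph_fst_law : has_law pi graph_fst Q.
Proof.
move=> S mS; rewrite Q_law// coupling_law_fst//.
by apply: preimage_measurable mS; exact: measurable_affine_graph.
Qed.

Lemma qot_cost_affine_graph_le : submodular h ->
  qot_well_defined c Q -> qot_well_defined c pi ->
  (qot_cost c Q <= qot_cost c pi)%E.
Proof.
move=> hs Qwd piwd.
have [QE Qdef] := integral_product_law measurable_graph_fst graph_fst_law h_meas.
rewrite [leLHS]QE.
apply: (integral_le_exact_transport (P := P) h_meas measurable_E
  _ _ (same_law_gUV hs)).
- exact: measurableT_comp (measurable_g hs) measurable_U.
- exact: measurableT_comp (measurable_g hs) measurable_V.
- exact: le_C.
- exact: (Qdef.1 Qwd).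
- exact: piwd.
Qed.

Lemma qot_cost_affine_graph_eq : strictly_submodular h ->
  qot_finite c Q -> qot_well_defined c pi ->
  (qot_cost c pi <= qot_cost c Q)%E ->
  (pi \x pi)%E [set z | `|z.1.1 - z.2.1| !=
    `|affine_inv z.1 - affine_inv z.2| ] = 0%E.
Proof.
move=> hss [Qwd Qfin] piwd piQ; have hs := strictly_submodularW hss.
have [QE Qdef] := integral_product_law measurable_graph_fst graph_fst_law h_meas.
have mgU := measurableT_comp (measurable_g hs) measurable_U.
have mgV := measurableT_comp (measurable_g hs) measurable_V.
have mE2 : measurable_fun setT (fun z => E z + ((g \o V) z - (g \o U) z) : T).
  by apply: measurable_funD => //; exact: measurable_funB.
rewrite /qot_cost [X in X \is a _]QE in Qfin.
rewrite /qot_cost [X in (_ <= X)%E]QE in piQ.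
have null : P [set z | C z != E z + ((g \o V) z - (g \o U) z)] = 0%E.
  apply: (exact_transport_ae_eq (P := P) h_meas measurable_E mgU mgV
    (same_law_gUV hs) (le_C hs)) => //.
  exact: (Qdef.1 Qwd).
apply: (subset_measure0 _ _ _ null).
- exact: (measurable_neq_set measurable_U measurable_V).
- exact: measurable_neq_set.
- move=> z /= UV; apply/negP => /eqP Ceq.
  have := diag_potential_lt (rescaled_strictly_submodular hss)
    (normr_ge0 _ : 0 <= U z) (normr_ge0 _ : 0 <= V z) UV.
  by rewrite -!gE ?normr_ge0// -CE -EE Ceq /= ltxx.
Qed.

(** In the case [Z = X + s], equality of the laws of [X] and [Z] gives [s = 0]:
compare the medians. *)
Lemma null_isometry_cases :
  (pi \x pi)%E [set z | `|z.1.1 - z.2.1| !=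
    `|affine_inv z.1 - affine_inv z.2| ] = 0%E ->
  has_law mu (affine_graph a b) pi \/
  exists m, has_law mu (affine (-1) m : T -> T) mu /\
    has_law mu (affine_graph (- a) (a * m + b)) pi.
Proof.
have invE (p : T * T) (s t : R) : affine_inv p = s * p.1 + t ->
    p.2 = affine (a * s) (a * t + b) p.1.
  rewrite /affine_inv /affine => E0.
  have : p.2 = a * ((p.2 - b) / a) + b.
    by rewrite mulrCA mulfV// mulr1 subrK.
  by rewrite E0 => ->; rewrite mulrDr mulrA addrA.
have mfst : measurable_fun setT (fst : T * T -> T) by [].
have law_of_affine (s t : R) :
    pi [set p | affine_inv p != affine s t p.1] = 0%E ->
    has_law mu (affine s t : T -> T) mu /\
    has_law mu (affine_graph (a * s) (a * t + b)) pi.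
  move=> N0.
  have mN : measurable [set p | affine_inv p != affine s t p.1].
    apply: measurable_neq_set; first exact: measurable_affine_inv.
    by apply: (measurableT_comp (@measurable_affine R s t)).
  split => S mS.
    have mS' : measurable ((affine s t : T -> T) @^-1` S).
      by apply: preimage_measurable mS; exact: measurable_affine.
    rewrite [LHS]coupling_law_affine_inv// [RHS]coupling_law_fst//.
    apply: (probability_eq_mod_null mN) => //.
    - by apply: preimage_measurable mS; exact: measurable_affine_inv.
    - exact: (preimage_measurable mfst mS').
    - by move=> p /= /negP; rewrite negbK => /eqP ->.
  have mS' : measurable (affine_graph (a * s) (a * t + b) @^-1` S).
    by apply: preimage_measurable mS; exact: measurable_affine_graph.
  rewrite [RHS]coupling_law_fst//; apply: (probability_eq_mod_null mN) => //.
    exact: (preimage_measurable mfst mS').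
  move=> p /= /negP; rewrite negbK => /eqP /invE pE.
  by rewrite /affine_graph -pE -surjective_pairing.
move=> null.
have [[s s0]|[m m0]] := isometric_ae mfst measurable_affine_inv null.
  have [] := law_of_affine 1 s.
    by rewrite -[RHS]s0; congr (pi _); apply/seteqP;
      split => p /=; rewrite /affine mul1r.
  move=> mus; have h01 : 0 < (2^-1 : R) < 1 by lra.
  have := quantile_affine ltr01 mus h01; rewrite /affine mul1r => qs.
  have -> : s = 0 by lra.
  by rewrite mulr1 mulr0 add0r; left.
right; exists m; have [] := law_of_affine (-1) m.
  by rewrite -[RHS]m0; congr (pi _); apply/seteqP;
    split => p /=; rewrite /affine mulN1r addrC.
by rewrite mulrN1.
Qed.

End one_coupling.

Lemma qot_minimizer_affine_graph (Q : probability (T * T)%type R) :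
  submodular h -> has_law mu (affine_graph a b) Q ->
  qot_well_defined c Q -> qot_minimizer c mu nu Q.
Proof.
move=> hs muQ Qwd; split.
  by split => //; exact: affine_graph_coupling.
move=> rho [rho_coupling rho_wd].
exact: qot_cost_affine_graph_le.
Qed.

Lemma qot_minimizer_cases (Q pi : probability (T * T)%type R) :
  strictly_submodular h -> has_law mu (affine_graph a b) Q ->
  qot_finite c Q -> qot_minimizer c mu nu pi ->
  has_law mu (affine_graph a b) pi \/
  exists m, has_law mu (affine (-1) m : T -> T) mu /\
    has_law mu (affine_graph (- a) (a * m + b)) pi.
Proof.
move=> hss muQ Qfin [[pi_coupling pi_wd] pi_min].
apply: null_isometry_cases => //.
apply: (qot_cost_affine_graph_eq pi_coupling muQ) => //.
apply: pi_min; split; first exact: affine_graph_coupling.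
by case: Qfin.
Qed.

(** The right-hand side depends on [a] through [|a|] only, so that the two
couplings of slopes [a] and [- a] have well-defined costs simultaneously. *)
Lemma qot_well_defined_affine_graph (Q : probability (T * T)%type R) :
  has_law mu (affine_graph a b) Q ->
  qot_well_defined c Q <->
  integral_defined (mu \x mu)%E
    (fun w => h `|w.1 - w.2| (`|a| * `|w.1 - w.2|)).
Proof.
move=> muQ.
have [_ def] := integral_product_law (@measurable_affine_graph R a b) muQ h_meas.
rewrite (_ : (fun w : T * T => _) = (fun w : T * T =>
  C (affine_graph a b w.1, affine_graph a b w.2)))//.
apply/funext => w; rewrite /C /abs_diff_cost /= /affine.
by rewrite opprD addrACA subrr addr0 -mulrBr normrM.
Qed.

End affine_optimality.

Section reflection.
Context {R : realType}.
Local Notation T := (measurableTypeR R).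
Implicit Types mu nu : probability T R.

Lemma symmetric_measureP mu :
  symmetric_measure mu <-> exists m, has_law mu (affine (-1) m : T -> T) mu.
Proof.
have imE m (A : set T) : [set m - x | x in A] = affine (-1) m @^-1` A.
  apply/seteqP; split => x /=; rewrite /affine mulN1r.
    by move=> [y Ay <-]; rewrite opprB subrK.
  by move=> Ax; exists (- x + m) => //; rewrite opprD opprK addrC subrK.
by split => -[m mm]; exists m => A /mm; rewrite imE.
Qed.

Lemma has_law_reflected mu nu a b m :
  has_law mu (affine (-1) m : T -> T) mu ->
  has_law mu (affine a b : T -> T) nu ->
  has_law mu (affine (- a) (a * m + b) : T -> T) nu.
Proof.
move=> mum munu A mA; rewrite munu// mum; last first.
  by apply: preimage_measurable mA; exact: measurable_affine.
congr (mu _); apply/seteqP; split => x /=; rewrite /affine;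
  by rewrite mulrDr mulrA mulrN1 addrA.
Qed.

(** [Q] is the monotone coupling of the direction of [a], and [Q'] that of the
opposite direction, which matters only when [mu] is symmetric. *)
Lemma qot_affine_graph mu nu (h : R -> R -> R) (a b : R)
    (Q Q' : probability (T * T)%type R) :
  a != 0 -> has_law mu (affine a b : T -> T) nu ->
  submodular h -> measurable_cost (abs_diff_cost h) ->
  has_law mu (affine_graph a b) Q ->
  (forall m, has_law mu (affine (-1) m : T -> T) mu ->
     has_law mu (affine_graph (- a) (a * m + b)) Q') ->
  let c := abs_diff_cost h in
  (qot_well_defined c Q -> qot_minimizer c mu nu Q) /\
  (qot_finite c Q -> strictly_submodular h ->
     (~ symmetric_measure mu -> forall pi,
        qot_minimizer c mu nu pi -> same_measure pi Q) /\
     (symmetric_measure mu -> forall pi,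
        qot_minimizer c mu nu pi <-> same_measure pi Q \/ same_measure pi Q')).
Proof.
move=> a0 munu hs mc muQ muQ' c; split.
  exact: (qot_minimizer_affine_graph a0 munu).
move=> Qfin hss.
have sameP f (Q1 Q2 : probability (T * T)%type R) :
    has_law mu f Q1 -> has_law mu f Q2 -> same_measure Q1 Q2.
  by move=> m1 m2 S mS; rewrite m1// m2.
split=> [asym pi pimin|sym pi].
  have [mupi|[m [mum _]]] := qot_minimizer_cases a0 munu mc hss muQ Qfin pimin.
    exact: sameP mupi muQ.
  by case: asym; apply/symmetric_measureP; exists m.
split=> [pimin|].
  have [mupi|[m [mum mupi]]] :=
      qot_minimizer_cases a0 munu mc hss muQ Qfin pimin.
    by left; exact: sameP mupi muQ.
  by right; exact: sameP mupi (muQ' _ mum).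
have [Qwd _] := Qfin.
have wd := qot_well_defined_affine_graph mc.
case=> [piQ|piQ'].
  have mupi : has_law mu (affine_graph a b) pi by move=> S mS; rewrite piQ// muQ.
  apply: (qot_minimizer_affine_graph a0 munu) => //.
  by apply/(wd _ _ _ _ mupi)/(wd _ _ _ _ muQ).
have /symmetric_measureP [m mum] := sym.
have mupi : has_law mu (affine_graph (- a) (a * m + b)) pi.
  by move=> S mS; rewrite piQ'// (muQ' _ mum).
apply: (qot_minimizer_affine_graph _ (has_law_reflected mum munu)) => //.
  by rewrite oppr_eq0.
by apply/(wd _ _ _ _ mupi); rewrite normrN; apply/(wd _ _ _ _ muQ).
Qed.

End reflection.

(** * Minimizers under a location-scale transform *)

Theorem theorem9 (R : realType)
    (mu nu : probability (measurableTypeR R) R) (h : R -> R -> R)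
    (h_submodular : submodular h)
    (h_measurable : measurable_cost (abs_diff_cost h)) :
  let c := abs_diff_cost h in
  (increasing_location_scale mu nu ->
     (qot_well_defined c (pi_com mu nu) ->
        qot_minimizer c mu nu (pi_com mu nu)) /\
     (qot_finite c (pi_com mu nu) -> strictly_submodular h ->
        (~ symmetric_measure mu -> forall pi,
           qot_minimizer c mu nu pi -> same_measure pi (pi_com mu nu)) /\
        (symmetric_measure mu -> forall pi,
           qot_minimizer c mu nu pi <->
           same_measure pi (pi_com mu nu) \/ same_measure pi (pi_ant mu nu)))) /\
  (decreasing_location_scale mu nu ->
     (qot_well_defined c (pi_ant mu nu) ->
        qot_minimizer c mu nu (pi_ant mu nu)) /\
     (qot_finite c (pi_ant mu nu) -> strictly_submodular h ->
        (~ symmetric_measure mu -> forall pi,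
           qot_minimizer c mu nu pi -> same_measure pi (pi_ant mu nu)) /\
        (symmetric_measure mu -> forall pi,
           qot_minimizer c mu nu pi <->
           same_measure pi (pi_com mu nu) \/ same_measure pi (pi_ant mu nu)))).
Proof.
move=> c; split=> [[a [b [a0 munu]]]|[a [b [a0 munu]]]].
  apply: (qot_affine_graph _ munu) => //; first by rewrite gt_eqF.
    exact: pi_com_affine.
  move=> m mum; apply: pi_ant_affine; first by rewrite oppr_lt0.
  exact: has_law_reflected.
have a_neq0 : a != 0 by rewrite lt_eqF.
have com_law m : has_law mu (affine (-1) m : measurableTypeR R -> measurableTypeR R) mu ->
    has_law mu (affine_graph (- a) (a * m + b)) (pi_com mu nu).
  move=> mum; apply: pi_com_affine; first by rewrite oppr_gt0.
  exact: has_law_reflected.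
have [min uniq] := qot_affine_graph a_neq0 munu h_submodular h_measurable
  (pi_ant_affine a0 munu) com_law.
split; first exact: min.
move=> fin hss; have [asym sym] := uniq fin hss; split; first exact: asym.
by move=> s pi; apply: (iff_trans (sym s pi)); exact: or_comm.
Qed.
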